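(* Let $(X,p,K)$ be a complete $K$-partial metric space and let $T_1,T_2:X\to X$ be mappings satisfying $$p(T_1x,T_2y)\le k\,p(x,y)\quad\text{for all }x,y\in X,$$ where $k\in[0,1)$ is a constant. Then $T_1$ and $T_2$ have a unique common fixed point $x^*\in X$, and for any $x\in X$ the orbits $\{T_1^{2n+1}x:\ n\ge 1\}$ and $\{T_2^{2n+2}x:\ n\ge 1\}$ converge to the fixed point.
   Context: A partial metric type on a set $X$ is a function $p:X\times X\to[0,\infty)$ such that: (pm1) for all $x,y\in X$, $x=y$ iff $p(x,x)=p(x,y)=p(y,y)$; (pm2) $p(x,x)\le p(x,y)$ for all $x,y\in X$; (pm3) $p(x,y)=p(y,x)$ for all $x,y\in X$; (pm4) there is a real number $K\ge 1$ such that $p(x,y)+p(z_1,z_1)+\cdots+p(z_N,z_N)\le K[p(x,z_1)+p(z_1,z_2)+\cdots+p(z_N,y)]$ for any points $x,y,z_1,\dots,z_N\in X$, where $N\ge 1$ is a fixed natural number. The triplet $(X,p,K)$ is called a $K$-partial metric space ($K$-PMS), or partial metric type space. A sequence $(x_n)$ in $X$ converges to $x\in X$ if $\lim_{n\to\infty}p(x_n,x)=p(x,x)$. It is Cauchy if $\lim_{n,m\to\infty}p(x_n,x_m)$ exists and is finite. $(X,p,K)$ is complete if for every Cauchy sequence $(x_n)$ in $X$ there is $x\in X$ with $\lim_{n,m\to\infty}p(x_n,x_m)=\lim_{n\to\infty}p(x_n,x)=p(x,x)$. *)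

(* Defs.v *)
From HB Require Import structures.
From mathcomp Require Import all_boot all_order all_algebra.
From mathcomp Require Import all_classical all_reals all_analysis.

Set Implicit Arguments.
Unset Strict Implicit.
Unset Printing Implicit Defensive.

Import Order.TTheory GRing.Theory Num.Theory.
Import numFieldNormedType.Exports.

Local Open Scope classical_set_scope.
Local Open Scope ring_scope.

(* In [pm4], [pairmap p x (rcons z y)] is the sequence of the N + 1 steps
   p x z_1, p z_1 z_2, ..., p z_N y of the chain from x to y through z. *)
Record is_partial_metric_type (R : realType) (X : Type) (N : nat) (K : R)
    (p : X -> X -> R) : Prop := IsPartialMetricType {
  pm_ge0 : forall x y, 0 <= p x y ;
  pm1 : forall x y, x = y <-> (p x x = p x y /\ p x y = p y y) ;
  pm2 : forall x y, p x x <= p x y ;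
  pm3 : forall x y, p x y = p y x ;
  pm_N_ge1 : (1 <= N)%N ;
  pm_K_ge1 : 1 <= K ;
  pm4 : forall (x y : X) (z : N.-tuple X),
    p x y + \sum_(c <- z) p c c
      <= K * \sum_(d <- pairmap p x (rcons z y)) d
}.

Section Convergence.
Variables (R : realType) (X : Type) (p : X -> X -> R).

Definition pm_converges (u : nat -> X) (x : X) : Prop :=
  (fun n => p (u n) x) @ \oo --> p x x.

(* The double limit, as n and m tend to infinity independently. *)
Definition pm_double_limit (u : nat -> X) (l : R) : Prop :=
  (fun nm : nat * nat => p (u nm.1) (u nm.2)) @ (\oo, \oo) --> l.

Definition pm_cauchy (u : nat -> X) : Prop :=
  exists l : R, pm_double_limit u l.

Definition pm_complete : Prop :=
  forall u : nat -> X, pm_cauchy u ->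
    exists x : X, pm_double_limit u (p x x) /\ pm_converges u x.

End Convergence.

Definition common_fixed_point (X : Type) (T1 T2 : X -> X) (x : X) : Prop :=
  T1 x = x /\ T2 x = x.

(* Main.v *)
Require Import Defs.
From HB Require Import structures.
From mathcomp Require Import all_boot all_order all_algebra.
From mathcomp Require Import all_classical all_reals all_analysis.
From mathcomp Require Import ring lra.
Import Order.TTheory GRing.Theory Num.Theory.
Import numFieldNormedType.Exports.
Local Open Scope ring_scope.

(** Repeating the endpoint [y] in the chain inequality (pm4) leaves a single
    intermediate point, and [p y y <= p z y] absorbs the repetitions; hence
    [p] obeys a triangle inequality up to the constant [C = K * N].

    The contraction condition couples [T1] with [T2] only.  It iterates to
    [p (T1^n x) (T2^n y) <= k^n * p x y], and passing through [T2^n y] turns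
    it into a statement about [T1] alone:
    [p (T1^n x) (T1^n y) <= 2 * C * k^n * p x y]
    ([iter_lipschitz_of_cross_contraction]).  Since [k < 1], some iterate
    [S = T1^r] is a contraction whose ratio is as small as desired, and a ratio
    of at most [1 / (2 * C)] is enough for the Picard argument to survive the
    constant [C] ([strong_contraction_fixpoint]).  This gives a fixed point
    [xs] of [S] with [p xs xs = 0].  The point [T1 xs] is fixed by [S] too, so
    [T1 xs = xs], and then [p xs (T2 xs) <= k * p xs xs = 0] gives
    [T2 xs = xs].

    Once a common fixed point is available, [T2^n xs = xs] reduces the
    iterated condition to [p (T1^n x) xs <= k^n * p x xs], which settles the
    convergence of the orbits, and symmetrically for [T2]; the case [n = 1]
    settles uniqueness. *)

Set Implicit Arguments.
Unset Strict Implicit.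

Definition relaxed_triangle (R : realType) (X : Type) (C : R)
    (p : X -> X -> R) : Prop :=
  forall x y z, p x y <= C * (p x z + p z y).

(** * Partial metric type spaces *)

Section PartialMetricType.
Variables (R : realType) (X : Type) (N : nat) (K : R) (p : X -> X -> R).
Hypothesis p_pm : is_partial_metric_type N K p.

Lemma pm_eq0 x y : p x y <= 0 -> x = y.
Proof.
move=> pxy_le0.
have pxy : p x y = 0 by apply: le_anti; rewrite pxy_le0 (pm_ge0 p_pm).
have self0 a : p a a <= 0 -> p a a = 0.
  by move=> paa; apply: le_anti; rewrite paa (pm_ge0 p_pm).
have pxx : p x x = 0 by rewrite self0// -pxy (pm2 p_pm).
have pyy : p y y = 0 by rewrite self0// -pxy (pm3 p_pm) (pm2 p_pm).
by apply/(pm1 p_pm); rewrite pxx pxy pyy.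
Qed.

Lemma pm_const_ge1 : 1 <= K * N%:R.
Proof.
rewrite -[leLHS]mulr1; apply: ler_pM => //; first exact: pm_K_ge1 p_pm.
by rewrite ler1n (pm_N_ge1 p_pm).
Qed.

(** The chain is [x, z, y, ..., y]: its [N - 1] steps from [y] to itself cost
    [p y y], which is at most [p z y]. *)
Lemma pm_relaxed_triangle : relaxed_triangle (K * N%:R) p.
Proof.
move=> x y z.
case: N p_pm => [|n] pm; first by have := pm_N_ge1 pm.
have := pm4 pm x y [tuple of z :: nseq n y].
have -> : rcons (z :: nseq n y) y = [:: z, y & nseq n y].
  by congr cons; elim: n {pm} => //= m ->.
have step : pairmap p y (nseq n y) = nseq n (p y y).
  by elim: n {pm} => //= m ->.
have sum_nseq T (F : T -> R) a : \sum_(c <- nseq n a) F c = n%:R * F a.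
  elim: n {pm step} => [|m IH] /=; first by rewrite big_nil mul0r.
  by rewrite big_cons IH -natr1; ring.
rewrite /= step !big_cons !sum_nseq -natr1.
have n_ge0 : 0 <= n%:R :> R by [].
have K_ge1 := pm_K_ge1 pm.
have pxz := pm_ge0 pm x z; have pzz := pm_ge0 pm z z.
have pyy := pm_ge0 pm y y.
have pyy_le : p y y <= p z y by rewrite (pm3 pm) (pm2 pm).
have absorb : n%:R * p y y <= n%:R * (p x z + p z y).
  by apply: ler_wpM2l => //; lra.
have absorbK : K * (n%:R * p y y) <= K * (n%:R * (p x z + p z y)).
  by apply: ler_wpM2l => //; lra.
have := mulr_ge0 n_ge0 pyy.
move: absorbK.
lra.
Qed.

(** The chain [p x x <= p x (T2 x) = p (T1 x) (T2 x) <= k * p x x]. *)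
Lemma pm_cross_eq0 (k : R) (T1 T2 : X -> X) x :
  k < 1 -> (forall a b, p (T1 a) (T2 b) <= k * p a b) ->
  T1 x = x -> p x x = 0.
Proof.
move=> k1 contr fx; apply: le_anti; rewrite (pm_ge0 p_pm) andbT.
have := contr x x; rewrite fx; have := pm2 p_pm x (T2 x).
by have := pm_ge0 p_pm x x; nra.
Qed.

End PartialMetricType.

(** * Contractions of small ratio *)

Lemma geometric_cvg0 (R : realType) (k B : R) : 0 <= k -> k < 1 ->
  ((fun n => k ^+ n * B) @ \oo --> (0 : R))%classic.
Proof.
move=> k0 k1; rewrite -(mul0r B); apply: cvgMl.
by apply: cvg_expr; rewrite ger0_norm.
Qed.

Lemma exists_expr_le (R : realType) (k c : R) : 0 <= k -> k < 1 -> 0 < c ->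
  exists n, k ^+ n <= c.
Proof.
move=> k0 k1 c0.
have kn : ((fun n => k ^+ n) @ \oo --> (0 : R))%classic.
  by apply: cvg_expr; rewrite ger0_norm.
have [n _ Hn] := cvgr_le _ kn _ c0.
by exists n; apply: Hn => /=.
Qed.

Lemma iter_contraction (R : realType) (X : Type) (p : X -> X -> R) (l : R)
    (S1 S2 : X -> X) : 0 <= l ->
  (forall x y, p (S1 x) (S2 y) <= l * p x y) ->
  forall n x y, p (iter n S1 x) (iter n S2 y) <= l ^+ n * p x y.
Proof.
move=> l0 Sl; elim=> [|n IH] x y /=; first by rewrite expr0 mul1r.
by apply: le_trans (Sl _ _) _; rewrite exprS -mulrA ler_wpM2l.
Qed.

(** Under [C * l <= 1/2] the recursive estimate
    [p x (S^(m+1) x) <= C * (p x (S x) + l * p x (S^m x))] reproduces the bound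
    [2 * C * p x (S x)] from [m] to [m + 1]. *)
Lemma orbit_bounded (R : realType) (X : Type) (N : nat) (K C l : R)
    (p : X -> X -> R) (S : X -> X) (x : X) :
  is_partial_metric_type N K p -> 1 <= C -> relaxed_triangle C p ->
  C * l <= 1/2 -> (forall x y, p (S x) (S y) <= l * p x y) ->
  forall m, p x (iter m S x) <= 2 * C * p x (S x).
Proof.
move=> pm C1 tri Cl Sl; elim=> [|m IH] /=.
  apply: le_trans (pm2 pm x (S x)) _.
  by have := pm_ge0 pm x (S x); nra.
have D0 := pm_ge0 pm x (iter m S x).
have := tri x (S (iter m S x)) (S x).
have : C * p (S x) (S (iter m S x)) <= C * (l * p x (iter m S x)).
  by apply: ler_wpM2l => //; lra.
have : C * l * p x (iter m S x) <= 1/2 * p x (iter m S x).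
  exact: ler_wpM2r.
lra.
Qed.

Lemma orbit_double_limit0 (R : realType) (X : Type) (N : nat) (K C l : R)
    (p : X -> X -> R) (S : X -> X) (x : X) :
  is_partial_metric_type N K p -> 1 <= C -> relaxed_triangle C p ->
  0 <= l -> C * l <= 1/2 -> (forall x y, p (S x) (S y) <= l * p x y) ->
  pm_double_limit p (fun n => iter n S x) 0.
Proof.
move=> pm C1 tri l0 Cl Sl.
have l1 : l < 1 by nra.
set B := 2 * C * p x (S x).
have B0 : 0 <= B by rewrite /B !mulr_ge0// ?(pm_ge0 pm)//; lra.
(* Shifting both indices back by [n] reduces to the orbit bound from [x]. *)
have shifted n j : p (iter n S x) (iter (n + j) S x) <= l ^+ n * B.
  rewrite iterD; apply: le_trans (iter_contraction l0 Sl n _ _) _.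
  apply: ler_wpM2l; first exact: exprn_ge0.
  exact: orbit_bounded pm C1 tri Cl Sl j.
have pos n : 0 <= l ^+ n * B by rewrite mulr_ge0// exprn_ge0.
apply: (@squeeze_cvgr _ _ _ _ (fun=> 0)
  (fun nm : nat * nat => l ^+ nm.1 * B + l ^+ nm.2 * B)).
- apply: nearW => -[n m] /=; rewrite (pm_ge0 pm) /=.
  case: (leqP n m) => [nm|/ltnW mn].
    by have := shifted n (m - n)%N; rewrite subnKC//; have := pos m; lra.
  by have := shifted m (n - m)%N; rewrite subnKC// (pm3 pm); have := pos n; lra.
- exact: cvg_cst.
- rewrite -(addr0 0); apply: cvgD.
    exact: (cvg_comp fst _ cvg_fst (geometric_cvg0 B l0 l1)).
  exact: (cvg_comp snd _ cvg_snd (geometric_cvg0 B l0 l1)).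
Qed.

(** The Picard limit [xs] is within [C * (l * p xs u_n + p u_(n+1) xs)] of
    [S xs] for each [n], and this bound tends to [0] because the double limit
    of the orbit, hence [p xs xs], is [0]. *)
Lemma strong_contraction_fixpoint (R : realType) (X : Type) (N : nat)
    (K C l : R) (p : X -> X -> R) (S : X -> X) :
  inhabited X -> is_partial_metric_type N K p -> pm_complete p ->
  1 <= C -> relaxed_triangle C p ->
  0 <= l -> C * l <= 1/2 -> (forall x y, p (S x) (S y) <= l * p x y) ->
  exists xs, S xs = xs.
Proof.
move=> [x] pm cpl C1 tri l0 Cl Sl.
have lim0 := orbit_double_limit0 x pm C1 tri l0 Cl Sl.
set u := fun n => iter n S x in lim0.
have [xs [lims ucv]] := cpl u (ex_intro _ 0 lim0).
have xs0 : p xs xs = 0 by exact: cvg_unique lims lim0.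
rewrite /pm_converges xs0 in ucv.
exists xs; apply: (pm_eq0 pm).
have bound_cvg : ((fun n => C * (l * p (u n) xs + p (u n.+1) xs)) @ \oo
    --> C * (l * 0 + 0))%classic.
  apply: cvgMr; apply: cvgD; first exact: cvgMr.
  by move: ucv; rewrite -(cvg_shiftS (fun n => p (u n) xs)).
rewrite mulr0 addr0 mulr0 in bound_cvg.
apply: (ler_cvg_to (cvg_cst (p (S xs) xs)) bound_cvg); apply: nearW => n.
apply: le_trans (tri _ _ (u n.+1)) _; apply: ler_wpM2l; first by lra.
by rewrite lerD2r (pm3 pm (u n)); exact: Sl.
Qed.

(** * Pairs of maps contracting each other *)

(** The intermediate point [T2^n y] is at distance at most [k^n * p x y] from
    [T1^n x] and at most [k^n * p y y <= k^n * p x y] from [T1^n y]. *)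
Lemma iter_lipschitz_of_cross_contraction (R : realType) (X : Type) (N : nat)
    (K C k : R) (p : X -> X -> R) (T1 T2 : X -> X) :
  is_partial_metric_type N K p -> 1 <= C -> relaxed_triangle C p -> 0 <= k ->
  (forall x y, p (T1 x) (T2 y) <= k * p x y) ->
  forall n x y, p (iter n T1 x) (iter n T1 y) <= 2 * C * k ^+ n * p x y.
Proof.
move=> pm C1 tri k0 contr n x y.
apply: le_trans (tri _ _ (iter n T2 y)) _.
rewrite (mulrC 2) -2!mulrA; apply: ler_wpM2l; first by lra.
have xy := iter_contraction k0 contr n x y.
have yy := iter_contraction k0 contr n y y.
have kn : 0 <= k ^+ n by exact: exprn_ge0.
have pyx : p y y <= p x y by rewrite (pm3 pm x); exact: pm2 pm y x.
have := ler_wpM2l kn pyx.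
rewrite (pm3 pm (iter n T2 y)); lra.
Qed.

Lemma cross_contraction_common_fixpoint (R : realType) (X : Type) (N : nat)
    (K k : R) (p : X -> X -> R) (T1 T2 : X -> X) :
  inhabited X -> is_partial_metric_type N K p -> pm_complete p ->
  0 <= k -> k < 1 -> (forall x y, p (T1 x) (T2 y) <= k * p x y) ->
  exists xs, common_fixed_point T1 T2 xs.
Proof.
move=> X0 pm cpl k0 k1 contr.
have [C C1 tri] : exists2 C, 1 <= C & relaxed_triangle C p.
  exists (K * N%:R); first exact: pm_const_ge1 pm.
  exact: pm_relaxed_triangle pm.
have C_neq0 : C != 0 by rewrite gt_eqF//; lra.
(* Chosen so that the ratio [2 * C * k^r] of [T1^r] is at most [1/(2 * C)]. *)
have [r kr] : exists r, k ^+ r <= (4 * C * C)^-1.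
  by apply: exists_expr_le => //; rewrite invr_gt0; nra.
have lip := iter_lipschitz_of_cross_contraction pm C1 tri k0 contr r.
set l := 2 * C * k ^+ r in lip.
have l0 : 0 <= l by rewrite /l !mulr_ge0 ?exprn_ge0//; lra.
have Cl : C * l <= 1/2.
  have -> : 1/2 = C * (2 * C * (4 * C * C)^-1) :> R by field.
  by rewrite /l; do 2!(apply: ler_wpM2l; first by lra).
have [xs Sxs] := strong_contraction_fixpoint X0 pm cpl C1 tri l0 Cl lip.
(* [S = T1^r] commutes with [T1], so it fixes [T1 xs] as well, while its
   ratio is less than [1]. *)
have T1xs : T1 xs = xs.
  apply: (pm_eq0 pm).
  have := lip (T1 xs) xs; rewrite -iterSr iterS Sxs.
  have := pm_ge0 pm (T1 xs) xs.
  by nra.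
exists xs; split=> //; apply/esym/(pm_eq0 pm).
have := contr xs xs.
by rewrite T1xs (pm_cross_eq0 pm k1 contr T1xs) mulr0.
Qed.

Lemma iter_fix (X : Type) (T : X -> X) x n : T x = x -> iter n T x = x.
Proof. by move=> Tx; elim: n => //= n ->. Qed.

(** Since [T2^n xs = xs], the iterated cross contraction bounds the distance
    from the [T1]-orbit to [xs] itself. *)
Lemma cross_contraction_orbit_cvg (R : realType) (X : Type) (N : nat)
    (K k : R) (p : X -> X -> R) (T1 T2 : X -> X) (xs x : X) (s : nat -> nat) :
  is_partial_metric_type N K p ->
  0 <= k -> k < 1 -> (forall x y, p (T1 x) (T2 y) <= k * p x y) ->
  common_fixed_point T1 T2 xs -> (forall n, n <= s n)%N ->
  pm_converges p (fun n => iter (s n) T1 x) xs.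
Proof.
move=> pm k0 k1 contr [T1xs T2xs] s_ge.
rewrite /pm_converges (pm_cross_eq0 pm k1 contr T1xs).
apply: (@squeeze_cvgr _ _ _ _ (fun=> 0) (fun n => k ^+ n * p x xs)).
- apply: nearW => n; rewrite (pm_ge0 pm) /=.
  rewrite -[X in p _ X](iter_fix (s n) T2xs).
  apply: le_trans (iter_contraction k0 contr _ _ _) _.
  apply: ler_wpM2r; first exact: pm_ge0 pm x xs.
  by apply: ler_wiXn2l => //; exact: ltW.
- exact: cvg_cst.
- exact: geometric_cvg0.
Qed.

Unset Implicit Arguments.

Theorem theorem2p4 (R : realType) (X : Type) (N : nat) (K : R)
    (p : X -> X -> R) (T1 T2 : X -> X) (k : R)
    (X_nonempty : inhabited X)
    (p_pm : is_partial_metric_type N K p)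
    (p_complete : pm_complete p)
    (k_ge0 : 0 <= k) (k_lt1 : k < 1)
    (contr : forall x y : X, p (T1 x) (T2 y) <= k * p x y) :
  exists xs : X,
    unique (common_fixed_point T1 T2) xs /\
    forall x : X,
      pm_converges p (fun n : nat => iter (2 * n.+1 + 1)%N T1 x) xs /\
      pm_converges p (fun n : nat => iter (2 * n.+1 + 2)%N T2 x) xs.
Proof.
have [xs fix_xs] := cross_contraction_common_fixpoint
  X_nonempty p_pm p_complete k_ge0 k_lt1 contr.
have index_ge c n : (n <= 2 * n.+1 + c)%N.
  by rewrite mul2n -addnn addSnnS -addnA leq_addr.
exists xs; split; first split=> // y [_ T2y].
  apply: (pm_eq0 p_pm).
  have [T1xs _] := fix_xs.
  have := contr xs y; rewrite T1xs T2y.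
  by have := pm_ge0 p_pm xs y; nra.
move=> x; split.
  exact: cross_contraction_orbit_cvg p_pm k_ge0 k_lt1 contr fix_xs (index_ge 1).
have contr' a b : p (T2 a) (T1 b) <= k * p a b.
  by rewrite (pm3 p_pm) (pm3 p_pm a); exact: contr.
have fix_xs' : common_fixed_point T2 T1 xs by case: fix_xs.
exact: cross_contraction_orbit_cvg p_pm k_ge0 k_lt1 contr' fix_xs' (index_ge 2).
Qed.
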